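(* For every $m\in\mathbb N\setminus\{2,3,5\}$, in the Ulam–Rényi game over $\{0,\dots,2^m-1\}$ with at most $3$ lies there exists a perfect strategy all of whose questions are $4$-interval questions.
   Context: Game: Responder picks $x\in\mathcal U=\{0,\dots,2^m-1\}$; Questioner asks questions ''$x\in Q$?'' with $Q\subseteq\mathcal U$; Responder may lie at most 3 times. A state is a map $\sigma:\mathcal U\to\{0,1,2,3,4\}$ (number of answers falsified by each element, truncated at 4); the initial state is identically $0$; after question $Q$, $\sigma_{yes}(y)=\min\{\sigma(y)+[y\notin Q],4\}$, $\sigma_{no}(y)=\min\{\sigma(y)+[y\in Q],4\}$. A state is final if $|\{y:\sigma(y)<4\}|\le1$. A strategy of size $q$ is a complete binary tree of depth $q$ with internal nodes labelled by questions, edges by answers; it is winning if the state at every leaf is final. $N_{\min}(2^m,3)=\min\{q:2^{q-m}\ge\sum_{i=0}^3\binom qi\}$; a perfect strategy is a winning strategy for the initial state of size $N_{\min}(2^m,3)$. An interval is $\emptyset$ or $\{x\in\mathcal U:a\le x\le b\}$; a 4-interval question is a union of at most 4 intervals. *)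

(* Defs.v *)
From mathcomp Require Import all_boot.
Set Implicit Arguments. Unset Strict Implicit. Unset Printing Implicit Defensive.


(* A state: number of falsified answers for each element, truncated at 4. *)
Definition state (n : nat) := 'I_n -> nat.

Definition init_state (n : nat) : state n := fun _ => 0.

Definition sigma_yes n (s : state n) (Q : {set 'I_n}) : state n :=
  fun y => minn (s y + (y \notin Q)) 4.
Definition sigma_no n (s : state n) (Q : {set 'I_n}) : state n :=
  fun y => minn (s y + (y \in Q)) 4.

Definition final n (s : state n) : Prop := #|[set y : 'I_n | s y < 4]| <= 1.

(* Binary trees whose internal nodes are labelled by questions;
   the left subtree follows the answer "yes", the right one "no". *)
Inductive strategy (n : nat) : Type :=
| Leaf : strategy n
| Node : {set 'I_n} -> strategy n -> strategy n -> strategy n.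
Arguments Leaf {n}.

Fixpoint complete n (q : nat) (t : strategy n) : Prop :=
  match t, q with
  | Leaf, 0 => True
  | Node _ ty tn, q'.+1 => complete q' ty /\ complete q' tn
  | _, _ => False
  end.

Fixpoint winning n (s : state n) (t : strategy n) : Prop :=
  match t with
  | Leaf => final s
  | Node Q ty tn => winning (sigma_yes s Q) ty /\ winning (sigma_no s Q) tn
  end.

Fixpoint all_questions n (P : {set 'I_n} -> Prop) (t : strategy n) : Prop :=
  match t with
  | Leaf => True
  | Node Q ty tn => P Q /\ all_questions P ty /\ all_questions P tn
  end.

(* Berlekamp condition 2^(q-m) >= sum_{i=0}^3 C(q,i), written without
   truncated subtraction as 2^m * sum_{i=0}^3 C(q,i) <= 2^q. *)
Definition berlekamp (m q : nat) : bool :=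
  2 ^ m * (\sum_(i < 4) 'C(q, i)) <= 2 ^ q.

Definition is_Nmin (m q : nat) : Prop :=
  berlekamp m q /\ forall q', q' < q -> ~~ berlekamp m q'.

Definition interval n (I : {set 'I_n}) : Prop :=
  I = set0 \/ exists a b : nat, I = [set x : 'I_n | a <= x <= b].

Definition four_interval n (Q : {set 'I_n}) : Prop :=
  exists Is : seq {set 'I_n},
    size Is <= 4 /\ (forall I, I \in Is -> interval I) /\ Q = \bigcup_(I <- Is) I.

Definition perfect (m : nat) (t : strategy (2 ^ m)) : Prop :=
  exists q, is_Nmin m q /\ complete q t /\ winning (@init_state (2 ^ m)) t.

(* Main.v *)
(* List the surviving candidates in increasing order and record how many answers
   each of them falsifies: a position of the game becomes a word over {0,1,2,3},
   and a question a bit mask on it.  A mask with at most 8 changes around the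
   circle, or its complement, selects a union of at most 4 intervals, so words
   may be rotated and reversed freely.

   Call pattern of a word the sequence of levels of its blocks of equal letters.
   A closed family of patterns is one in which every admissible choice of the
   numbers of elements to select in each level is realised by some 4-interval
   question whose two answers lead again to patterns of the family.  One such
   family allows exact halving of all levels; m halvings lead to the position
   (1, m, C(m,2), C(m,3)).  A second family allows arbitrary choices as long as
   level 0 is not cut, which reduces the rest of the game to a game on the four
   level sizes.

   In that game an element of level i has weight sum_(j <= 3-i) C(r,j) when r
   questions are left, and the elements of level 3, of weight 1, are used to
   split the total volume into equal halves.  For n >= 18 remaining questions,
   halving levels 1 and 2 works down to 10 questions, where every position whose
   elements of level < 3 have weight at most 847 is won by a greedy strategy. *)
Require Import Defs.
From Stdlib Require Import BinNat Nnat.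
From mathcomp Require Import all_boot zify.
Set Implicit Arguments. Unset Strict Implicit. Unset Printing Implicit Defensive.

(** * Masks and intervals *)

(** Mostly used as [alt x (rcons s x)]: the letter [x] closes the mask to a circle, and the changes
    around it are counted. *)
Fixpoint alt (x : bool) (s : seq bool) : nat :=
  if s is y :: s' then (x != y) + alt y s' else 0.

Lemma alt_cat x s t : alt x (s ++ t) = alt x s + alt (last x s) t.
Proof. by elim: s x => [|y s IH] x //=; rewrite IH addnA. Qed.

Lemma alt_tri x y s : alt x s <= (x != y) + alt y s.
Proof. by case: s => [|z s] //=; case: x y z => [] [] [] /=; lia. Qed.

Lemma alt_rev x y s : alt x (rcons (rev s) y) = alt y (rcons s x).
Proof.
elim: s x y => [|z s IH] x y /=; first by rewrite eq_sym.
rewrite rev_cons -cats1 alt_cat IH last_rcons /= addn0 addnC.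
by rewrite [z == y]eq_sym.
Qed.

Lemma alt_negb x s : alt (~~ x) (map negb s) = alt x s.
Proof. by elim: s x => [|y s IH] x //=; rewrite IH; case: x y => [] []. Qed.

Definition inside (i : nat) (p : nat * nat) := p.1 <= i < p.2.

Lemma inside_shift i (J : seq (nat * nat)) :
  has (inside i.+1) [seq (p.1.+1, p.2.+1) | p <- J] = has (inside i) J.
Proof. by rewrite has_map; apply: eq_has => p. Qed.

Lemma inside_shift0 (J : seq (nat * nat)) :
  has (inside 0) [seq (p.1.+1, p.2.+1) | p <- J] = false.
Proof. by rewrite has_map; elim: J. Qed.

(** The second half serves the induction: behind a letter [true] an interval is already open, its
    remainder is [0, c), and it costs only its closing change. *)
Lemma alt_intervals s :
  (exists J : seq (nat * nat), 2 * size J <= alt false (rcons s false) /\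
     forall i, nth false s i = has (inside i) J) /\
  (exists c (J : seq (nat * nat)), (2 * size J).+1 <= alt true (rcons s false) /\
     forall i, nth false s i = (i < c) || has (inside i) J).
Proof.
elim: s => [|b s [[J [szJ nJ]] [c [K [szK nK]]]]].
  by split; [exists [::] | exists 0, [::]]; split=> // i; rewrite nth_nil.
case: b; split.
- exists ((0, c.+1) :: [seq (p.1.+1, p.2.+1) | p <- K]).
  split=> [/=|[|i]] //=; first by rewrite size_map; lia.
  by rewrite inside_shift nK.
- exists c.+1, [seq (p.1.+1, p.2.+1) | p <- K]; split=> [|[|i]] //=.
  + by rewrite size_map.
  + by rewrite inside_shift nK.
- exists [seq (p.1.+1, p.2.+1) | p <- J]; split=> [|[|i]] /=.
  + by rewrite size_map.
  + by rewrite inside_shift0.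
  + by rewrite inside_shift nJ.
- exists 0, [seq (p.1.+1, p.2.+1) | p <- J]; split=> [|[|i]] /=.
  + by rewrite size_map; lia.
  + by rewrite inside_shift0.
  + by rewrite inside_shift nJ.
Qed.

Lemma alt_four_interval n (s : seq bool) :
  alt false (rcons s false) <= 8 ->
  four_interval [set y : 'I_n | nth false s y].
Proof.
move=> le8; have [[J [szJ nJ]] _] := alt_intervals s.
exists [seq [set x : 'I_n | inside x p] | p <- J]; split; first by rewrite size_map; lia.
split=> [I /mapP[[a b] _ ->]|].
  (* Pairs are half-open: the closed right end is one less, and right end 0 gives the empty set. *)
  case: b => [|b]; first by left; apply/setP=> x; rewrite !inE /inside ltn0 andbF.
  by right; exists a, b; apply/setP=> x; rewrite !inE.
apply/setP=> x; rewrite inE nJ bigcup_seq; apply/hasP/bigcupP => [[p pJ ip]|[I]].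
  by exists [set x : 'I_n | inside x p]; rewrite ?map_f ?inE.
by case/mapP=> p pJ -> ; rewrite inE => ip; exists p.
Qed.

(** * The game on words *)

Definition ans (y : bool) (b : seq bool) (w : seq nat) : seq nat :=
  [seq l <- [seq p.1 + (p.2 != y) | p <- zip w b] | l < 4].

(** The closing letter [x] is free: [false] gives unions of at most four intervals, [true] gives
    complements of such unions. *)
Fixpoint winW (r : nat) (w : seq nat) : Prop :=
  if r is r'.+1 then
    exists (b : seq bool) (x : bool),
      [/\ size b = size w, alt x (rcons b x) <= 8,
          winW r' (ans true b w) & winW r' (ans false b w)]
  else size w <= 1.

Lemma ans_cat y b1 b2 w1 w2 : size b1 = size w1 ->
  ans y (b1 ++ b2) (w1 ++ w2) = ans y b1 w1 ++ ans y b2 w2.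
Proof. by move=> sz; rewrite /ans zip_cat // map_cat filter_cat. Qed.

Lemma ans_rev y b w : size b = size w -> ans y (rev b) (rev w) = rev (ans y b w).
Proof. by move=> sz; rewrite /ans -rev_zip // map_rev filter_rev. Qed.

Lemma winW_rev r w : winW r w -> winW r (rev w).
Proof.
elim: r w => [|r IH] w /=; first by rewrite size_rev.
case=> b [x [sz le8 wy wn]]; exists (rev b), x.
by rewrite !size_rev alt_rev !ans_rev //; split=> //; apply: IH.
Qed.

(** The last letter of [b1] closes the rotated mask, so no new change arises there; dropping the old
    [x] between [b2] and [b1] adds none, by the triangle inequality [alt_tri]. *)
Lemma alt_rot x b1 b2 :
  alt (last x b1) (rcons (b2 ++ b1) (last x b1)) <= alt x (rcons (b1 ++ b2) x).
Proof.
case: b1 => [|y b1]; first by rewrite cats0.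
set z := last x _; rewrite -!cats1 -!catA !alt_cat.
have -> : last (last z b2) (y :: b1) = z by [].
rewrite -/z /= eqxx !addn0.
by have := alt_tri (last z b2) x (y :: b1) => /=; lia.
Qed.

Lemma winW_catC r u v : winW r (u ++ v) -> winW r (v ++ u).
Proof.
elim: r u v => [|r IH] u v /=; first by rewrite !size_cat addnC.
case=> b [x [sz le8]]; rewrite -(cat_take_drop (size u) b) in le8 *.
have s1 : size (take (size u) b) = size u by rewrite size_takel // sz size_cat leq_addr.
have s2 : size (drop (size u) b) = size v by rewrite size_drop sz size_cat addKn.
move: (take _ b) (drop _ b) s1 s2 le8 => b1 b2 s1 s2 le8 {sz}.
rewrite !ans_cat // => wy wn; exists (b2 ++ b1), (last x b1).
rewrite !ans_cat // !size_cat s1 s2; split=> //; try exact: IH.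
exact: leq_trans (alt_rot _ _ _) le8.
Qed.

(* Eliminated candidates copy the answer of their predecessor, so that they
   create no new change of the mask. *)
Fixpoint lift_mask (x : bool) (b : seq bool) (w : seq nat) : seq bool :=
  if w is l :: w' then
    if l < 4 then head x b :: lift_mask (head x b) (behead b) w'
    else x :: lift_mask x b w'
  else [::].

Lemma size_lift_mask x b w : size (lift_mask x b w) = size w.
Proof. by elim: w x b => [|l w IH] x b //=; case: ifP; rewrite /= IH. Qed.

Lemma alt_lift_mask x e b w : size b = size [seq l <- w | l < 4] ->
  alt x (rcons (lift_mask x b w) e) = alt x (rcons b e).
Proof.
elim: w x b => [|l w IH] x b /=; first by case: b.
case: ifP => l4 /=; last by move=> sz; rewrite eqxx IH.
by case: b => [|y b] //= [sz]; rewrite IH.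
Qed.

Lemma ans_lift_mask y x b w : size b = size [seq l <- w | l < 4] ->
  [seq l <- [seq minn (p.1 + (p.2 != y)) 4 | p <- zip w (lift_mask x b w)] | l < 4]
  = ans y b [seq l <- w | l < 4].
Proof.
elim: w x b => [|l w IH] x b /=; first by case: b.
case: ifP => l4 /=.
  case: b => [|z b] //= [sz]; rewrite IH // /ans /=.
  have -> : (minn (l + (z != y)) 4 < 4) = (l + (z != y) < 4) by lia.
  by case: ifP => // lt4; congr (_ :: _); lia.
by move=> sz; rewrite IH //; case: ifP => //; lia.
Qed.

Definition statew n (s : state n) : seq nat := [seq l <- map s (enum 'I_n) | l < 4].

Lemma statew_ans n (s t : state n) (M : seq bool) (y : bool) : size M = n ->
  (forall z, t z = minn (s z + (nth false M z != y)) 4) ->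
  map t (enum 'I_n) = [seq minn (p.1 + (p.2 != y)) 4 | p <- zip (map s (enum 'I_n)) M].
Proof.
move=> szM tE.
have -> : M = [seq nth false M (val z) | z <- enum 'I_n].
  rewrite (map_comp (nth false M) val) val_enum_ord.
  by rewrite -[in LHS](mkseq_nth false M) szM.
elim: (enum 'I_n) => [|z e IH] //=.
by rewrite IH tE.
Qed.

Theorem winW_strategy n r (s : state n) : winW r (statew s) ->
  exists t, [/\ complete r t, winning s t & all_questions (@four_interval n) t].
Proof.
elim: r s => [|r IH] s /=.
  move=> le1; exists Leaf; split=> //=; rewrite /final cardE.
  suff -> : size (enum [set y : 'I_n | s y < 4]) = size (statew s) by [].
  rewrite /statew [RHS]size_filter count_map enumT /enum_mem size_filter.
  by apply: eq_count => y /=; rewrite inE.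
case=> b [x [szb le8 wy wn]].
pose M := lift_mask x b (map s (enum 'I_n)).
have szM : size M = n by rewrite size_lift_mask size_map size_enum_ord.
have altM : alt x (rcons M x) <= 8 by rewrite alt_lift_mask.
have next y (t : state n) : (forall z, t z = minn (s z + (nth false M z != y)) 4) ->
    statew t = ans y b (statew s).
  by move=> tE; rewrite /statew (statew_ans szM tE) ans_lift_mask.
move: M szM altM next => M szM altM next.
case: x {le8} altM => altM.
(* With closing letter [true] the complement of the mask is asked, and the two answers exchange
   roles. *)
- pose Q := [set z : 'I_n | nth false (map negb M) z].
  have QE z : (z \in Q) = ~~ nth false M z.
    by rewrite inE (nth_map false) // szM.
  have [|ty [cy wiy qy]] := IH (sigma_no s Q).
    rewrite (next true) // => z; rewrite /sigma_no QE.
    by case: (nth _ _ _).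
  have [|tn [cn win qn]] := IH (sigma_yes s Q).
    rewrite (next false) // => z; rewrite /sigma_yes QE negbK.
    by case: (nth _ _ _).
  exists (Node Q tn ty); split=> //=; split=> //.
  by apply: alt_four_interval; rewrite -[false]/(~~ true) -map_rcons alt_negb.
- pose Q := [set z : 'I_n | nth false M z].
  have QE z : (z \in Q) = nth false M z by rewrite inE.
  have [|ty [cy wiy qy]] := IH (sigma_yes s Q).
    rewrite (next true) // => z; rewrite /sigma_yes QE.
    by case: (nth _ _ _).
  have [|tn [cn win qn]] := IH (sigma_no s Q).
    rewrite (next false) // => z; rewrite /sigma_no QE.
    by case: (nth _ _ _).
  exists (Node Q ty tn); split=> //=; split=> //.
  exact: alt_four_interval.
Qed.

(** * Patterns *)

Definition word (B : seq (nat * nat)) : seq nat := flatten [seq nseq p.2 p.1 | p <- B].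

Lemma word_cat B C : word (B ++ C) = word B ++ word C.
Proof. by rewrite /word map_cat flatten_cat. Qed.

Lemma word_rev B : word (rev B) = rev (word B).
Proof.
elim: B => [|p B IH] //; rewrite rev_cons -cats1 word_cat IH -cat1s word_cat rev_cat.
by rewrite /word /= !cats0 rev_nseq.
Qed.

(* A pattern p is embedded in S when every word with pattern p also has
   pattern S, blocks being allowed to be empty. *)
Fixpoint strip (s : nat) (p : seq nat) : seq nat :=
  if p is l :: p' then if l == s then strip s p' else p else [::].

Fixpoint embed (p S : seq nat) : bool :=
  if S is s :: S' then embed (strip s p) S' else nilp p.

Lemma stripP s P : exists k P', strip s (unzip1 P) = unzip1 P' /\
  word P = nseq k s ++ word P'.
Proof.
elim: P => [|[l n] P [k [P' [sE wE]]]] /=; first by exists 0, [::].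
case: eqP => [->|_]; last by exists 0, ((l, n) :: P).
exists (n + k), P'; split=> //.
by rewrite /word /= -/(word P) wE catA nseqD.
Qed.

Lemma embedP S P : embed (unzip1 P) S -> exists B, unzip1 B = S /\ word B = word P.
Proof.
elim: S P => [|s S IH] P /=; first by case: P => // _; exists [::].
have [k [P' [-> ->]]] := stripP s P => /IH[B [<- wE]].
by exists ((s, k) :: B); split=> //; rewrite -wE.
Qed.

Definition fits_in (F : seq (seq nat)) (p : seq nat) : bool :=
  has (fun i => has (fun S => embed (rot i p) S || embed (rev (rot i p)) S) F)
      (iota 0 (size p).+1).

Lemma fits_in_winW F r P : fits_in F (unzip1 P) ->
  (forall B, unzip1 B \in F -> perm_eq (word B) (word P) -> winW r (word B)) ->
  winW r (word P).
Proof.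
case/hasP=> i _ /hasP[S SF /orP emb] win.
have wrot : winW r (word (rot i P)) -> winW r (word P).
  by rewrite /rot word_cat => /winW_catC; rewrite -word_cat cat_take_drop.
have prot : perm_eq (word (rot i P)) (word P).
  by rewrite -[X in perm_eq _ (word X)](cat_take_drop i) /rot !word_cat perm_catC.
apply: wrot; case: emb => emb.
  have /embedP[B [SE wE]] : embed (unzip1 (rot i P)) S by rewrite /unzip1 map_rot.
  by rewrite -wE; apply: win; rewrite ?SE // wE.
have /embedP[B [SE wE]] : embed (unzip1 (rev (rot i P))) S.
  by rewrite /unzip1 map_rev map_rot.
rewrite -[word (rot i P)]revK -word_rev; apply: winW_rev.
by rewrite -wE; apply: win; rewrite ?SE // wE word_rev perm_rev.
Qed.

(* Pieces ((l, b), n): n consecutive elements of level l, selected iff b. *)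
Local Notation piece := ((nat * bool) * nat)%type.

Definition pword (P : seq piece) : seq nat := flatten [seq nseq t.2 t.1.1 | t <- P].
Definition pmask (P : seq piece) : seq bool := flatten [seq nseq t.2 t.1.2 | t <- P].
Definition cnt (q : nat * bool) (P : seq piece) := sumn [seq t.2 | t <- P & t.1 == q].

Lemma cnt_cons q t P : cnt q (t :: P) = (if t.1 == q then t.2 else 0) + cnt q P.
Proof. by rewrite /cnt /=; case: eqP. Qed.

Lemma cnt_cat q P R : cnt q (P ++ R) = cnt q P + cnt q R.
Proof. by rewrite /cnt filter_cat map_cat sumn_cat. Qed.

Definition pattern_ans (y : bool) (p : seq (nat * bool)) : seq nat :=
  [seq l <- [seq q.1 + (q.2 != y) | q <- p] | l < 4].
Definition pieces_ans (y : bool) (P : seq piece) : seq (nat * nat) :=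
  [seq t <- [seq (t.1.1 + (t.1.2 != y), t.2) | t <- P] | t.1 < 4].

Lemma unzip1_pieces_ans y P : unzip1 (pieces_ans y P) = pattern_ans y (unzip1 P).
Proof.
elim: P => [|t P IH] //=; rewrite /pieces_ans /pattern_ans /=.
by case: ifP => //= _; congr (_ :: _).
Qed.

Lemma ans_pieces y P : ans y (pmask P) (pword P) = word (pieces_ans y P).
Proof.
elim: P => [|[[l b] n] P IH] //=; rewrite /pmask /pword /=.
rewrite ans_cat ?size_nseq // IH /pieces_ans /=.
suff -> : ans y (nseq n b) (nseq n l) =
    if l + (b != y) < 4 then nseq n (l + (b != y)) else [::] by case: ifP.
rewrite /ans; elim: n => [|n IHn] /=; first by case: ifP.
by rewrite IHn; case: (_ < 4).
Qed.

Lemma size_pmask P : size (pmask P) = size (pword P).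
Proof.
elim: P => [|t P IH] //=; rewrite /pmask /pword /= !size_cat !size_nseq.
by congr (_ + _).
Qed.

Lemma alt_pmask x e P : alt x (rcons (pmask P) e) <= alt x (rcons (unzip2 (unzip1 P)) e).
Proof.
elim: P x => [|[[l b] n] P IH] x //=; rewrite /pmask /= -/(pmask P) rcons_cat.
have {}IH := IH b; case: n => [|n] /=.
  by apply: leq_trans (alt_tri _ b _) _; rewrite leq_add2l.
rewrite leq_add2l; elim: n => [|n IHn] //=.
by rewrite eqxx.
Qed.

Lemma count_word l B : count_mem l (word B) = sumn [seq p.2 | p <- B & p.1 == l].
Proof.
elim: B => [|p B IH] //=; rewrite /word /= count_cat count_nseq IH /=.
by case: eqP => _; rewrite ?mul1n.
Qed.

Lemma count_pword l P : count_mem l (pword P) = cnt (l, true) P + cnt (l, false) P.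
Proof.
elim: P => [|[[k b] n] P IH] //=; rewrite /pword /= count_cat count_nseq IH /cnt /=.
by rewrite !xpair_eqE; case: eqP => _; case: b => /=; lia.
Qed.

Lemma count_pieces_ans y l P : l < 4 ->
  count_mem l (word (pieces_ans y P)) =
  cnt (l, y) P + (if l is k.+1 then cnt (k, ~~ y) P else 0).
Proof.
move=> l4; rewrite count_word; elim: P => [|[[k b] n] P IH]; first by case: l l4.
have -> : sumn [seq p.2 | p <- pieces_ans y ((k, b, n) :: P) & p.1 == l] =
    (if k + (b != y) == l then n else 0) + sumn [seq p.2 | p <- pieces_ans y P & p.1 == l].
  rewrite /pieces_ans /= -/(pieces_ans y P).
  case: (ltnP (k + (b != y)) 4) => [_|k4] /=; first by case: ifP.
  by case: eqP => // kE; move: l4 k4; rewrite -kE ltnNge => /negbTE->.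
rewrite IH !cnt_cons /= !xpair_eqE; case: l l4 {IH} => [|l] _ /=; first rewrite !addn0.
  by congr (_ + _); case: b; case: y; case: k.
rewrite cnt_cons xpair_eqE; move: (cnt _ _) (cnt _ _) => u v.
by case: b; case: y; rewrite /= ?addn0 ?addn1 ?andbT ?andbF;
  do ![case: eqP => ? /=]; lia.
Qed.

(* What a question does to a block: [Some true] selects all of it, [Some false]
   nothing, and [None] cuts it in two.  Inside a level all cuts have the same
   number of selected elements; the direction of a cut depends on the level. *)
Local Notation slice := (option bool).

Definition slice_block (c : nat) (d : bool) (x : slice) (p : nat * nat) : seq piece :=
  match x with
  | Some b => [:: ((p.1, b), p.2)]
  | None => if d then [:: ((p.1, true), c); ((p.1, false), p.2 - c)]
            else [:: ((p.1, false), p.2 - c); ((p.1, true), c)]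
  end.

Definition slice_letter (d : bool) (x : slice) (l : nat) : seq (nat * bool) :=
  match x with
  | Some b => [:: (l, b)]
  | None => [:: (l, d); (l, ~~ d)]
  end.

Definition next_slice (v : nat -> seq slice) (l : nat) : nat -> seq slice :=
  fun k => if k == l then behead (v k) else v k.

Fixpoint slice_blocks (c : nat -> nat) (d : nat -> bool) (v : nat -> seq slice)
    (B : seq (nat * nat)) : seq piece :=
  if B is p :: B' then
    slice_block (c p.1) (d p.1) (head (Some false) (v p.1)) p
      ++ slice_blocks c d (next_slice v p.1) B'
  else [::].

(** Shadow of [slice_blocks] without block sizes; it turns closure of a family into a finite
    computation. *)
Fixpoint slice_pattern (d : nat -> bool) (v : nat -> seq slice) (S : seq nat)
    : seq (nat * bool) :=
  if S is l :: S' then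
    slice_letter (d l) (head (Some false) (v l)) l ++ slice_pattern d (next_slice v l) S'
  else [::].

Lemma unzip1_slice_blocks c d v B :
  unzip1 (slice_blocks c d v B) = slice_pattern d v (unzip1 B).
Proof.
elim: B v => [|[l n] B IH] v //=; rewrite /unzip1 map_cat -/unzip1 -/(unzip1 _) IH.
by congr (_ ++ _); rewrite /slice_block /slice_letter /=; case: (head _ _) => [|] //; case: (d l).
Qed.

Definition level (l : nat) (B : seq (nat * nat)) : seq nat :=
  [seq p.2 | p <- B & p.1 == l].

Fixpoint selected (c : nat) (v : seq slice) (b : seq nat) : nat :=
  if b is n :: b' then
    (match head (Some false) v with Some true => n | Some false => 0 | None => c end)
      + selected c (behead v) b'
  else 0.

(** Guards the truncated [p.2 - c] in [slice_block]. *)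
Fixpoint room (c : nat) (v : seq slice) (b : seq nat) : bool :=
  if b is n :: b' then
    (if head (Some false) v is None then c <= n else true) && room c (behead v) b'
  else true.

Lemma cnt_slice_blocks c d v B l :
  cnt (l, true) (slice_blocks c d v B) = selected (c l) (v l) (level l B).
Proof.
elim: B v => [|[k n] B IH] v //=; rewrite cnt_cat IH /level /= /next_slice.
rewrite [l == k]eq_sym; set x := head _ _.
have -> : cnt (l, true) (slice_block (c k) (d k) x (k, n)) =
    (if k == l then match x with Some true => n | Some false => 0 | None => c k end else 0).
  rewrite /slice_block; case: x => [[]|]; last case: (d k);
    by rewrite !cnt_cons /= !xpair_eqE ?andbT ?andbF; case: eqP; rewrite /cnt /= ?addn0.
by rewrite {}/x; case: eqP => [->|] //=.
Qed.

Lemma pword_slice_blocks c d v B : (forall l, room (c l) (v l) (level l B)) ->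
  pword (slice_blocks c d v B) = word B.
Proof.
elim: B v => [|[k n] B IH] v //= rm.
rewrite /pword map_cat flatten_cat -/(pword (slice_blocks _ _ _ _)) IH; last first.
  move=> l; have := rm l; rewrite /level /= /next_slice [l == k]eq_sym.
  by case: eqP => //= _ /andP[].
rewrite /word /=; congr (_ ++ _).
have := rm k; rewrite /level /= eqxx /= => /andP[rk _].
case: (head _ _) rk => [b _|le_c] /=; first by rewrite cats0.
by case: (d k); rewrite /= cats0 -nseqD; congr nseq; lia.
Qed.

(** Closing with the first letter of the mask adds no change, so [alt] counts the changes of the
    cyclic pattern itself. *)
Definition good_question (F : seq (seq nat)) (p : seq (nat * bool)) : bool :=
  let x := head true (unzip2 p) in
  [&& alt x (rcons (unzip2 p) x) <= 8, fits_in F (pattern_ans true p)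
    & fits_in F (pattern_ans false p)].

Definition directions : seq (seq bool) :=
  [seq a :: s | a <- [:: true; false], s <- [seq b :: t | b <- [:: true; false], t <-
   [seq [:: e; f] | e <- [:: true; false], f <- [:: true; false]]]].

(* Each s_l lists, for the blocks of level l, sets of alternatives such that
   all members of at least one of them realise the wanted number of elements. *)
Definition closed_family (F : seq (seq nat)) (s0 s1 s2 s3 : seq (seq (seq slice))) : bool :=
  all (fun S => all (fun t0 => all (fun t1 => all (fun t2 => all (fun t3 =>
    has (fun v0 => has (fun v1 => has (fun v2 => has (fun v3 => has (fun d =>
      good_question F (slice_pattern (nth true d) (nth [::] [:: v0; v1; v2; v3]) S))
    directions) t3) t2) t1) t0) s3) s2) s1) s0) F.

Definition covers (s : seq (seq (seq slice))) (b : seq nat) (a : nat) : Prop :=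
  exists2 t, t \in s & forall v, v \in t -> exists c, room c v b /\ selected c v b = a.

(** The computation picks one member of each covering set without knowing the block sizes. All
    members realise the requested number, so whatever it picks is a question with the right
    counts. *)
Lemma closed_family_step F s0 s1 s2 s3 r B (a : nat -> nat) :
  closed_family F s0 s1 s2 s3 -> unzip1 B \in F ->
  covers s0 (level 0 B) (a 0) -> covers s1 (level 1 B) (a 1) ->
  covers s2 (level 2 B) (a 2) -> covers s3 (level 3 B) (a 3) ->
  (forall y B', unzip1 B' \in F ->
     (forall l, l < 4 -> count_mem l (word B') =
        (if y then a l else count_mem l (word B) - a l) +
        (if l is k.+1 then (if y then count_mem k (word B) - a k else a k) else 0)) ->
     winW r (word B')) ->
  winW r.+1 (word B).
Proof.
move=> /allP cl BF [t0 t0s h0] [t1 t1s h1] [t2 t2s h2] [t3 t3s h3] win.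
have {cl} /allP/(_ _ t0s)/allP/(_ _ t1s)/allP/(_ _ t2s)/allP/(_ _ t3s) := cl _ BF.
case/hasP=> v0 /h0[c0 [r0 e0]] /hasP[v1 /h1[c1 [r1 e1]]].
case/hasP=> v2 /h2[c2 [r2 e2]] /hasP[v3 /h3[c3 [r3 e3]]] /hasP[d _].
set v := nth [::] _; pose c := nth 0 [:: c0; c1; c2; c3].
pose P := slice_blocks c (nth true d) v B.
rewrite -(unzip1_slice_blocks c) -/P => /and3P[altP fy fn].
have rm l : room (c l) (v l) (level l B).
  case: l => [|[|[|[|l]]]] //; rewrite /v /= nth_nil.
  by elim: (level _ _).
have wP : pword P = word B by apply: pword_slice_blocks.
have cT l : l < 4 -> cnt (l, true) P = a l.
  by case: l => [|[|[|[|l]]]] // _; rewrite cnt_slice_blocks.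
have cF l : l < 4 -> cnt (l, false) P = count_mem l (word B) - a l.
  by move=> l4; rewrite -wP count_pword cT // addKn.
exists (pmask P), (head true (unzip2 (unzip1 P))); rewrite -wP size_pmask !ans_pieces.
split=> //; first exact: leq_trans (alt_pmask _ _ _) altP.
- apply: (@fits_in_winW F) => [|B' B'F /permP pB']; first by rewrite unzip1_pieces_ans.
  apply: (win true) => // l l4; rewrite pB' count_pieces_ans // cT //.
  by case: l l4 => [|l] l4 //; rewrite cF // ltnW.
- apply: (@fits_in_winW F) => [|B' B'F /permP pB']; first by rewrite unzip1_pieces_ans.
  apply: (win false) => // l l4; rewrite pB' count_pieces_ans // cF //.
  by case: l l4 => [|l] l4 //; rewrite cT // ltnW.
Qed.

(** * The two closed families *)

Local Notation all_of := (Some true).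
Local Notation none_of := (Some false).
Local Notation part_of := (@None bool).

(* Found by computing a greatest fixed point over all cyclic patterns with at
   most 1, 2, 3, 3 blocks of the respective levels. *)
Definition endgame_patterns : seq (seq nat) :=
  [:: [:: 2; 3; 0; 1; 2; 1; 3; 2; 3]; [:: 0; 1; 2; 3; 1; 2; 3; 2; 3];
      [:: 0; 1; 2; 3; 2; 1; 3; 2; 3]; [:: 0; 1; 2; 3; 2; 3; 1; 2; 3];
      [:: 1; 0; 3; 1; 2; 3; 2; 3; 2]; [:: 0; 1; 3; 2; 1; 2; 3; 2; 3];
      [:: 0; 1; 3; 2; 3; 2; 1; 2; 3]].

(** One set for each way in which the requested number can compare with the two block sizes; in each
    case two ways of cutting a single block work. *)
Definition two_any : seq (seq (seq slice)) :=
  [:: [:: [:: part_of; none_of]; [:: none_of; part_of]];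
      [:: [:: part_of; all_of]; [:: all_of; part_of]];
      [:: [:: part_of; none_of]; [:: part_of; all_of]];
      [:: [:: none_of; part_of]; [:: all_of; part_of]]].

Definition three_prefix : seq (seq (seq slice)) :=
  [:: [:: [:: part_of; none_of; none_of]]; [:: [:: all_of; part_of; none_of]];
      [:: [:: all_of; all_of; part_of]]].

Lemma endgame_closed :
  closed_family endgame_patterns [:: [:: [:: all_of]]] two_any three_prefix three_prefix.
Proof. by vm_compute. Qed.

(** Here level 0 must be cut too; in return only exact halves are requested. *)
Definition halving_patterns : seq (seq nat) :=
  [:: [:: 0; 1; 2; 3; 2; 3; 1; 2]; [:: 0; 1; 3; 2; 3; 2; 1; 2];
      [:: 0; 1; 3; 2; 1; 2; 3; 2]; [:: 0; 1; 2; 3; 2; 1; 3; 2];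
      [:: 0; 1; 2; 3; 1; 2; 3; 2]].

(** The larger block holds at least half of the level, so it can be cut whether the other one is
    selected or not. *)
Definition two_half : seq (seq (seq slice)) :=
  [:: [:: [:: part_of; none_of]; [:: part_of; all_of]];
      [:: [:: none_of; part_of]; [:: all_of; part_of]]].

(** A block holding at least half can be cut with the other two treated in any way. If there is
    none, any two blocks together exceed half: one is taken whole, one in part, one not at all. *)
Definition three_half : seq (seq (seq slice)) :=
  [:: [seq [:: part_of; x; y] | x <- [:: all_of; none_of], y <- [:: all_of; none_of]];
      [seq [:: x; part_of; y] | x <- [:: all_of; none_of], y <- [:: all_of; none_of]];
      [seq [:: x; y; part_of] | x <- [:: all_of; none_of], y <- [:: all_of; none_of]];
      [:: [:: part_of; all_of; none_of]; [:: part_of; none_of; all_of];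
          [:: all_of; part_of; none_of]; [:: none_of; part_of; all_of];
          [:: all_of; none_of; part_of]; [:: none_of; all_of; part_of]]].

Lemma halving_closed :
  closed_family halving_patterns [:: [:: [:: part_of]]] two_half three_half two_half.
Proof. by vm_compute. Qed.

Lemma halving_endgame : all (fits_in endgame_patterns) halving_patterns.
Proof. by vm_compute. Qed.

(** Level 0 is always selected whole, so a negative answer empties it. *)
Fixpoint winT (r x0 x1 x2 x3 : nat) : Prop :=
  if r is r'.+1 then
    exists a1 a2 a3,
      [/\ a1 <= x1, a2 <= x2, a3 <= x3,
          winT r' x0 a1 (a2 + (x1 - a1)) (a3 + (x2 - a2))
        & winT r' 0 (x0 + (x1 - a1)) (a1 + (x2 - a2)) (a2 + (x3 - a3))]
  else x0 + x1 + x2 + x3 <= 1.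

(** * Realising requested numbers by cuts, and winning from the two families *)

Lemma size_level l B : size (level l B) = count_mem l (unzip1 B).
Proof. by rewrite size_map size_filter count_map. Qed.

Lemma count_level l B : count_mem l (word B) = sumn (level l B).
Proof. exact: count_word. Qed.

Lemma covers_all n : covers [:: [:: [:: Some true]]] [:: n] n.
Proof.
exists [:: [:: Some true]] => // v; rewrite inE => /eqP->.
by exists 0; split=> //=; rewrite addn0.
Qed.

Lemma covers_part n a : a <= n -> covers [:: [:: [:: None]]] [:: n] a.
Proof.
move=> le_a; exists [:: [:: None]] => // v; rewrite inE => /eqP->.
by exists a; rewrite /= le_a addn0.
Qed.

Lemma covers_two_any b0 b1 a : a <= b0 + b1 -> covers two_any [:: b0; b1] a.
Proof.
move=> le_a; case: (leqP a b0) => h0; case: (leqP a b1) => h1.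
- exists (nth [::] two_any 0) => // v; rewrite !inE => /orP[] /eqP->; exists a; split=> /=; lia.
- exists (nth [::] two_any 2) => // v; rewrite !inE => /orP[] /eqP->;
    [exists a | exists (a - b1)]; split=> /=; lia.
- exists (nth [::] two_any 3) => // v; rewrite !inE => /orP[] /eqP->;
    [exists a | exists (a - b0)]; split=> /=; lia.
- exists (nth [::] two_any 1) => // v; rewrite !inE => /orP[] /eqP->;
    [exists (a - b1) | exists (a - b0)]; split=> /=; lia.
Qed.

Lemma covers_three_prefix b0 b1 b2 a : a <= b0 + b1 + b2 ->
  covers three_prefix [:: b0; b1; b2] a.
Proof.
move=> le_a; case: (leqP a b0) => h0; last case: (leqP a (b0 + b1)) => h1.
- exists (nth [::] three_prefix 0) => // v; rewrite !inE => /eqP->; exists a; split=> /=; lia.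
- exists (nth [::] three_prefix 1) => // v; rewrite !inE => /eqP->; exists (a - b0);
    split=> /=; lia.
- exists (nth [::] three_prefix 2) => // v; rewrite !inE => /eqP->; exists (a - b0 - b1);
    split=> /=; lia.
Qed.

Lemma covers_two_half b0 b1 a : b0 + b1 = 2 * a -> covers two_half [:: b0; b1] a.
Proof.
move=> eq_a; case: (leqP b1 b0) => h.
- exists (nth [::] two_half 0) => // v; rewrite !inE => /orP[] /eqP->;
    [exists a | exists (a - b1)]; split=> /=; lia.
- exists (nth [::] two_half 1) => // v; rewrite !inE => /orP[] /eqP->;
    [exists a | exists (a - b0)]; split=> /=; lia.
Qed.

Lemma covers_three_half b0 b1 b2 a : b0 + b1 + b2 = 2 * a ->
  covers three_half [:: b0; b1; b2] a.
Proof.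
move=> eq_a; case: (leqP a b0) => h0; last case: (leqP a b1) => h1; last case: (leqP a b2) => h2.
- exists (nth [::] three_half 0) => // v; rewrite !inE => /or4P[] /eqP->;
    [exists (a - b1 - b2) | exists (a - b1) | exists (a - b2) | exists a]; split=> /=; lia.
- exists (nth [::] three_half 1) => // v; rewrite !inE => /or4P[] /eqP->;
    [exists (a - b0 - b2) | exists (a - b0) | exists (a - b2) | exists a]; split=> /=; lia.
- exists (nth [::] three_half 2) => // v; rewrite !inE => /or4P[] /eqP->;
    [exists (a - b0 - b1) | exists (a - b0) | exists (a - b1) | exists a]; split=> /=; lia.
exists (nth [::] three_half 3) => // v.
rewrite !inE => /or4P[/eqP-> | /eqP-> | /eqP-> | /or3P[] /eqP->];
  [exists (a - b1) | exists (a - b2) | exists (a - b0) | exists (a - b2) | exists (a - b0)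
  | exists (a - b1)]; split=> /=; lia.
Qed.

Lemma size_counts w : all (fun l => l < 4) w ->
  size w = count_mem 0 w + count_mem 1 w + count_mem 2 w + count_mem 3 w.
Proof.
elim: w => [|l w IH] //= /andP[l4 /IH->].
by case: l l4 => [|[|[|[|l]]]] //= _; lia.
Qed.

Lemma all_word (a : pred nat) B : all a (unzip1 B) -> all a (word B).
Proof.
elim: B => [|p B IH] //= /andP[ap aB].
by rewrite /word /= all_cat -/(word B) IH // all_nseq ap orbT.
Qed.

Lemma endgame_win r B : unzip1 B \in endgame_patterns ->
  winT r (count_mem 0 (word B)) (count_mem 1 (word B)) (count_mem 2 (word B))
         (count_mem 3 (word B)) ->
  winW r (word B).
Proof.
elim: r B => [|r IH] B BF.
  rewrite /= size_counts // all_word //.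
  by move: BF; apply/allP; vm_compute.
case=> a1 [a2 [a3 [le1 le2 le3 Ty Tn]]].
have sizes : [&& size (level 0 B) == 1, size (level 1 B) == 2,
    size (level 2 B) == 3 & size (level 3 B) == 3].
  rewrite !size_level; move: (unzip1 B) BF; apply/allP; exact: isT.
pose a := nth 0 [:: count_mem 0 (word B); a1; a2; a3].
apply: (@closed_family_step _ _ _ _ _ _ _ a endgame_closed BF); rewrite /a /=.
- rewrite count_level; move: sizes => /and4P[+ _ _ _]; case: (level 0 B) => [|n []] //= _.
  by rewrite addn0; apply: covers_all.
- move: le1; rewrite count_level; move: sizes => /and4P[_ + _ _].
  by case: (level 1 B) => [|b0 [|b1 []]] //= _; rewrite addn0; apply: covers_two_any.
- move: le2; rewrite count_level; move: sizes => /and4P[_ _ + _].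
  case: (level 2 B) => [|b0 [|b1 [|b2 []]]] //= _; rewrite addn0 addnA.
  exact: covers_three_prefix.
- move: le3; rewrite count_level; move: sizes => /and4P[_ _ _ +].
  case: (level 3 B) => [|b0 [|b1 [|b2 []]]] //= _; rewrite addn0 addnA.
  exact: covers_three_prefix.
move=> y B' B'F cE; apply: IH => //; rewrite !cE // {cE} /a /=.
case: y; rewrite ?subnn ?addn0 //.
by rewrite [_ + count_mem 0 _]addnC [_ + a1]addnC [_ + a2]addnC.
Qed.

(** By Pascal's rule both answers to an exact halving turn the sizes 2^k C(j, i) into 2^(k-1) C(j+1,
    i). When no halving is left, the word passes to the endgame family. *)
Lemma halving_win k j r B : unzip1 B \in halving_patterns ->
  count_mem 0 (word B) = 2 ^ k -> count_mem 1 (word B) = 2 ^ k * j ->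
  count_mem 2 (word B) = 2 ^ k * 'C(j, 2) -> count_mem 3 (word B) = 2 ^ k * 'C(j, 3) ->
  winT r 1 (j + k) 'C(j + k, 2) 'C(j + k, 3) -> winW (k + r) (word B).
Proof.
elim: k j B => [|k IH] j B BF e0 e1 e2 e3.
  rewrite expn0 ?mul1n in e0 e1 e2 e3; rewrite addn0 => win.
  apply: (@fits_in_winW endgame_patterns) => [|B' B'F /permP pB'].
    by move/allP: halving_endgame; apply.
  by apply: endgame_win; rewrite // !pB' e0 e1 e2 e3.
move=> win; rewrite addSn.
have sizes : [&& size (level 0 B) == 1, size (level 1 B) == 2,
    size (level 2 B) == 3 & size (level 3 B) == 2].
  rewrite !size_level; move: (unzip1 B) BF; apply/allP; exact: isT.
pose a := nth 0 [:: 2 ^ k; 2 ^ k * j; 2 ^ k * 'C(j, 2); 2 ^ k * 'C(j, 3)].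
apply: (@closed_family_step _ _ _ _ _ _ _ a halving_closed BF); rewrite /a /=.
- move: e0; rewrite count_level; move: sizes => /and4P[+ _ _ _].
  by case: (level 0 B) => [|n []] //= _; rewrite addn0 => ->; apply: covers_part;
    rewrite expnS; lia.
- move: e1; rewrite count_level; move: sizes => /and4P[_ + _ _].
  case: (level 1 B) => [|b0 [|b1 []]] //= _; rewrite addn0 expnS -mulnA.
  exact: covers_two_half.
- move: e2; rewrite count_level; move: sizes => /and4P[_ _ + _].
  case: (level 2 B) => [|b0 [|b1 [|b2 []]]] //= _; rewrite addn0 addnA expnS -mulnA.
  exact: covers_three_half.
- move: e3; rewrite count_level; move: sizes => /and4P[_ _ _ +].
  case: (level 3 B) => [|b0 [|b1 []]] //= _; rewrite addn0 expnS -mulnA.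
  exact: covers_two_half.
move=> y B' B'F cE.
by apply: (IH j.+1) => //; rewrite ?cE ?addSnnS // ?e0 ?e1 ?e2 ?e3 /a /= expnS ?binS ?bin1;
  case: y cE => _; lia.
Qed.

Lemma initial_win m r : winT r 1 m 'C(m, 2) 'C(m, 3) -> winW (m + r) (nseq (2 ^ m) 0).
Proof.
(* The single initial block has this pattern, all other blocks being empty. *)
move=> win; have [|B [BE wE]] := @embedP [:: 0; 1; 2; 3; 2; 3; 1; 2] [:: (0, 2 ^ m)].
  by [].
have {wE} wE : word B = nseq (2 ^ m) 0 by rewrite wE /word /= cats0.
by rewrite -wE; apply: (@halving_win m 0); rewrite ?BE ?wE ?count_nseq //= ?mul1n ?muln0.
Qed.

Theorem winT_perfect m r : is_Nmin m (m + r) -> winT r 1 m 'C(m, 2) 'C(m, 3) ->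
  exists t : strategy (2 ^ m), perfect t /\ all_questions (@four_interval (2 ^ m)) t.
Proof.
move=> Nm /initial_win win.
have [|t [ct wt qt]] := @winW_strategy (2 ^ m) (m + r) (@init_state _).
  suff -> : statew (@init_state (2 ^ m)) = nseq (2 ^ m) 0 by [].
  rewrite /statew (_ : map _ _ = nseq (2 ^ m) 0); first by elim: (2 ^ m) => //= n ->.
  rewrite -[in RHS](size_enum_ord (2 ^ m)).
  by elim: (enum _) => //= x s ->.
by exists t; split=> //; exists (m + r).
Qed.

(** * The game on level sizes *)

Lemma winT_mono r x0 x1 x2 x3 y0 y1 y2 y3 :
  y0 <= x0 -> y1 <= x1 -> y2 <= x2 -> y3 <= x3 ->
  winT r x0 x1 x2 x3 -> winT r y0 y1 y2 y3.
Proof.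
elim: r x0 x1 x2 x3 y0 y1 y2 y3 => [|r IH] x0 x1 x2 x3 y0 y1 y2 y3 l0 l1 l2 l3 /=.
  by move=> ?; lia.
case=> a1 [a2 [a3 [m1 m2 m3 wy wn]]].
exists (minn a1 y1), (minn a2 y2), (minn a3 y3); split; try lia.
  by apply: IH wy; lia.
by apply: IH wn; lia.
Qed.

Definition wt2 r := r.+1.
Definition wt1 r := 'C(r, 2) + wt2 r.
Definition wt0 r := 'C(r, 3) + wt1 r.

Lemma wt1S r : wt1 r.+1 = wt1 r + wt2 r.
Proof. by rewrite /wt1 /wt2 binS bin1; lia. Qed.

Lemma wt0S r : wt0 r.+1 = wt0 r + wt1 r.
Proof. by rewrite /wt0 wt1S binS /wt1; lia. Qed.

Definition low r x0 x1 x2 := wt0 r * x0 + wt1 r * x1 + wt2 r * x2.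

(* Won with any number of elements of level 3, which weigh 1, within volume 2^r. *)
Definition fillable r x0 x1 x2 :=
  forall x3, x3 + low r x0 x1 x2 <= 2 ^ r -> winT r x0 x1 x2 x3.

Lemma fillable_step r x0 x1 x2 a1 a2 : a1 <= x1 -> a2 <= x2 ->
  low r x0 a1 (a2 + (x1 - a1)) + (x2 - a2) <= 2 ^ r ->
  low r 0 (x0 + (x1 - a1)) (a1 + (x2 - a2)) + a2 <= 2 ^ r ->
  fillable r x0 a1 (a2 + (x1 - a1)) ->
  fillable r 0 (x0 + (x1 - a1)) (a1 + (x2 - a2)) ->
  fillable r.+1 x0 x1 x2.
Proof.
move=> le1 le2 vy vn fy fn x3 v3.
have [u1 x1E] : exists u1, x1 = a1 + u1 by exists (x1 - a1); lia.
have [u2 x2E] : exists u2, x2 = a2 + u2 by exists (x2 - a2); lia.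
subst x1 x2; rewrite !addKn in vy vn fy fn.
(* Conservation of volume: an element stays under one answer and rises a level under the other, and
   its weight is the sum of the two resulting weights. *)
have lowE : low r.+1 x0 (a1 + u1) (a2 + u2) =
    low r x0 a1 (a2 + u1) + u2 + (low r 0 (x0 + u1) (a1 + u2) + a2).
  by rewrite /low wt0S wt1S /wt2; lia.
rewrite lowE expnS in v3.
(* Level 3 fills the yes side up to 2^r as far as it lasts; the remainder fits on the other side. *)
exists a1, a2, (minn x3 (2 ^ r - (low r x0 a1 (a2 + u1) + u2))).
by rewrite !addKn; split; try lia; [apply: fy | apply: fn]; lia.
Qed.

(** The two volumes differ by at most C(r,3) for the element of level 0, C(r,2) for an odd element
    of level 1 and r for one of level 2. *)
Lemma fillable_halve r x0 x1 x2 V : x0 <= 1 ->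
  low r.+1 x0 x1 x2 + ('C(r, 3) + 'C(r, 2) + r) <= 2 * V -> V <= 2 ^ r ->
  (forall y0 y1 y2, y0 <= 1 -> low r y0 y1 y2 <= V -> fillable r y0 y1 y2) ->
  fillable r.+1 x0 x1 x2.
Proof.
move=> le1 leV leV2 fill.
have [a1 [e1 [le_e1 x1E]]] : exists a1 e1, e1 <= 1 /\ x1 = a1 + (a1 + e1).
  by exists (x1./2), (odd x1); split; [case: (odd _) | have := odd_double_half x1; lia].
have [a2 [e2 [le_e2 x2E]]] : exists a2 e2, e2 <= 1 /\ x2 = a2 + (a2 + e2).
  by exists (x2./2), (odd x2); split; [case: (odd _) | have := odd_double_half x2; lia].
have vy : low r x0 a1 (a2 + (a1 + e1)) + (a2 + e2) <= V.
  move: leV; rewrite x1E x2E /low wt0S wt1S /wt0 /wt1 /wt2 {x1E x2E}.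
  by case: x0 le1 => [|[]] // _; case: e1 le_e1 => [|[]] // _; case: e2 le_e2 => [|[]] // _; lia.
have vn : low r 0 (x0 + (a1 + e1)) (a1 + (a2 + e2)) + a2 <= V.
  move: leV; rewrite x1E x2E /low wt0S wt1S /wt0 /wt1 /wt2 {x1E x2E vy}.
  by case: x0 le1 => [|[]] // _; case: e1 le_e1 => [|[]] // _; case: e2 le_e2 => [|[]] // _; lia.
apply: (@fillable_step _ _ _ _ a1 a2); rewrite ?x1E ?x2E ?leq_addr // ?addKn;
  try by apply: leq_trans leV2.
- by apply: fill => //; lia.
- by apply: fill => //; lia.
Qed.

(** * Greedy play computed with binary numbers *)

Local Notation low_state := (N * N * N)%type.

Local Open Scope N_scope.

Fixpoint wtN (r : nat) : low_state :=
  if r is r'.+1 then let: (a, b, c) := wtN r' in (a + b, b + c, c + 1) else (1, 1, 1).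

Fixpoint powN (r : nat) : N := if r is r'.+1 then let p := powN r' in p + p else 1.

Definition lowN (w x : low_state) : N :=
  let: (a, b, c) := w in let: (x0, x1, x2) := x in a * x0 + b * x1 + c * x2.

Definition yesN (x : low_state) (a : N * N) : low_state :=
  let: (x0, x1, x2) := x in (x0, a.1, a.2 + (x1 - a.1)).
Definition noN (x : low_state) (a : N * N) : low_state :=
  let: (x0, x1, x2) := x in (0, x0 + (x1 - a.1), a.1 + (x2 - a.2)).

Definition vyesN w (x : low_state) a := lowN w (yesN x a) + (x.2 - a.2).
Definition vnoN w (x : low_state) a := lowN w (noN x a) + a.2.

Definition legalN w p (x : low_state) (a : N * N) : bool :=
  [&& a.1 <=? x.1.2, a.2 <=? x.2, vyesN w x a <=? p & vnoN w x a <=? p].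

Definition moves (x : low_state) : seq (N * N) :=
  let near n := let h := N.div2 n in [:: h - 1; h; h + 1] in
  [seq (a1, a2) | a1 <- near x.1.2, a2 <- near x.2].

Definition imbalance w x a : N :=
  let y := vyesN w x a in let n := vnoN w x a in (y - n) + (n - y).

(** A heuristic about which nothing needs proof: [layer] checks every chosen move again, including
    the default (0, 0). *)
Definition choose w p (x : low_state) : N * N :=
  let ms := [seq (imbalance w x a, a) | a <- moves x & legalN w p x a] in
  (foldr (fun a b => if a.1 <=? b.1 then a else b) (head (0, (0, 0)) ms) ms).2.

(** All positions with r questions left are treated together and deduplicated, which avoids
    exploring an exponential tree. *)
Fixpoint layer (r : nat) (l : seq low_state) : bool :=
  if r is r'.+1 then
    let w := wtN r' in let p := powN r' in
    let ms := [seq (x, choose w p x) | x <- l] in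
    all (fun t => legalN w p t.1 t.2) ms &&
    layer r' (undup ([seq yesN t.1 t.2 | t <- ms] ++ [seq noN t.1 t.2 | t <- ms]))
  else true.

Local Close Scope N_scope.


Lemma wtNE r : wtN r = (N.of_nat (wt0 r), N.of_nat (wt1 r), N.of_nat (wt2 r)).
Proof.
elim: r => [|r IH] //=; rewrite IH wt0S wt1S /wt2.
by congr (_, _, _); lia.
Qed.

Lemma powNE r : powN r = N.of_nat (2 ^ r).
Proof. by elim: r => [|r IH] //=; rewrite IH expnS; lia. Qed.

Lemma layer_sound r l : layer r l -> forall x, x \in l ->
  fillable r (N.to_nat x.1.1) (N.to_nat x.1.2) (N.to_nat x.2).
Proof.
elim: r l => [|r IH] l /=.
  (* With no question left all weights are 1, so volume at most 1 means at most one candidate. *)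
  by move=> _ x _ x3; rewrite /low /wt0 /wt1 /wt2 !bin0n /= expn0; lia.
case/andP=> /allP legal /IH {}IH x xl.
set ms := [seq (_, _) | _ <- l] in legal IH.
have [a xa] : exists a : N * N, (x, a) \in ms.
  by exists (choose (wtN r) (powN r) x); apply/mapP; exists x.
have fy : yesN x a \in undup ([seq yesN t.1 t.2 | t <- ms] ++ [seq noN t.1 t.2 | t <- ms]).
  by rewrite mem_undup mem_cat; apply/orP; left; apply/mapP; exists (x, a).
have fn : noN x a \in undup ([seq yesN t.1 t.2 | t <- ms] ++ [seq noN t.1 t.2 | t <- ms]).
  by rewrite mem_undup mem_cat; apply/orP; right; apply/mapP; exists (x, a).
have {legal} := legal _ xa; have {fy} := IH _ fy; have {IH fn} := IH _ fn.
case: x a {xa xl} => [[x0 x1] x2] [a1 a2].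
rewrite /legalN /vyesN /vnoN powNE.
case: (wtN r) (wtNE r) => [[w0 w1] w2] [w0E w1E w2E] /= fn fy.
case/and4P=> /N.leb_spec0 l1 /N.leb_spec0 l2 /N.leb_spec0 vy /N.leb_spec0 vn.
have {}w2E : w2 = N.of_nat (wt2 r) := w2E; subst w0 w1 w2.
have Ey : N.to_nat (a2 + (x1 - a1)) = N.to_nat a2 + (N.to_nat x1 - N.to_nat a1) by lia.
have E1 : N.to_nat (x0 + (x1 - a1)) = N.to_nat x0 + (N.to_nat x1 - N.to_nat a1) by lia.
have E2 : N.to_nat (a1 + (x2 - a2)) = N.to_nat a1 + (N.to_nat x2 - N.to_nat a2) by lia.
rewrite Ey in fy; rewrite E1 E2 in fn.
apply: (fillable_step _ _ _ _ fy fn); rewrite /low; lia.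
Qed.

(** The weights at r = 10 are 176, 56 and 11, so volume at most 847 forces x1 < 16 and x2 < 78. *)
Definition base_states : seq low_state :=
  [seq x <- [seq (p, N.of_nat x2) |
               p <- [seq (x0, N.of_nat x1) | x0 <- [:: 0%num; 1%num], x1 <- iota 0 16],
               x2 <- iota 0 78]
   | (lowN (wtN 10) x <=? 847)%num].

Lemma layer_base : layer 10 base_states.
Proof. by vm_compute. Qed.

Lemma fillable_base x0 x1 x2 : x0 <= 1 -> low 10 x0 x1 x2 <= 847 -> fillable 10 x0 x1 x2.
Proof.
move=> le1 le847; have lowE : low 10 x0 x1 x2 = 176 * x0 + 56 * x1 + 11 * x2 by [].
rewrite lowE in le847.
have := layer_sound layer_base (x := (N.of_nat x0, N.of_nat x1, N.of_nat x2)).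
rewrite /= !Nat2N.id; apply; rewrite mem_filter; apply/andP; split.
  by apply/N.leb_spec0; rewrite (_ : wtN 10 = (176, 56, 11)%num) // /lowN; lia.
apply/allpairsP; exists ((N.of_nat x0, N.of_nat x1), x2);
  split; [|by rewrite mem_iota /=; lia|by []].
apply/allpairsP; exists (N.of_nat x0, x1); split; [|by rewrite mem_iota /=; lia|by []].
by case: x0 le1 {le847 lowE} => [|[]].
Qed.

(* The recursion slackS absorbs the rounding error of one halving; at r = 10 the
   threshold of fillable_low is 604 + slack 10 = 847. *)
Definition slack r := 3 + 3 * r + 2 * 'C(r, 2) + 'C(r, 3).

Lemma slackS r : slack r.+1 + ('C(r, 3) + 'C(r, 2) + r) = 2 * slack r.
Proof. by rewrite /slack !binS bin1; lia. Qed.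

(** 420 = 1024 - 604, so the threshold of [fillable_low] stays within 2^(10 + j). *)
Lemma slack_le j : slack (10 + j) <= 420 * 2 ^ j.
Proof.
elim: j => [|j IH]; first by vm_compute.
by have := slackS (10 + j); rewrite addnS expnS; lia.
Qed.

Lemma fillable_low j x0 x1 x2 : x0 <= 1 ->
  low (10 + j) x0 x1 x2 <= 604 * 2 ^ j + slack (10 + j) -> fillable (10 + j) x0 x1 x2.
Proof.
elim: j x0 x1 x2 => [|j IH] x0 x1 x2 le1.
  by rewrite addn0 => /fillable_base; apply.
rewrite addnS => leL; have := slackS (10 + j); have := slack_le j => sl slS.
apply: (fillable_halve (V := 604 * 2 ^ j + slack (10 + j))) => //.
  by move: leL; rewrite expnS; lia.
by rewrite expnD (_ : 2 ^ 10 = 1024) //; lia.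
Qed.

(** Exact halvings split the volume equally, so after m of them the volume is still the initial
    weight of one candidate. *)
Lemma low_binom m n : low n 1 m 'C(m, 2) + 'C(m, 3) = wt0 (m + n).
Proof.
elim: m n => [|m IH] n; first by rewrite /low !muln0 muln1 /= !addn0.
by rewrite addSnnS -IH /low wt0S wt1S /wt2 !binS bin1; lia.
Qed.

(** * Cubic estimates of the volume *)

Lemma double_bin2 s : 2 * 'C(s, 2) + s = s ^ 2.
Proof.
elim: s => [|s IH] //; rewrite binS bin1 mulnDr.
by move: IH; rewrite !expnS expn0 !muln1; lia.
Qed.

Lemma wt0_cubic s : 6 * wt0 s = s ^ 3 + 5 * s + 6.
Proof.
elim: s => [|s IH] //; rewrite wt0S mulnDr IH; have := double_bin2 s.
by rewrite /wt1 /wt2 !expnS expn0 !muln1; lia.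
Qed.

Lemma leq_wt0 s t : s <= t -> wt0 s <= wt0 t.
Proof. by move=> /subnK <-; elim: (t - s) => [|k IH] //; rewrite addSn wt0S; lia. Qed.

(** Covers m < 4n. The bound fails for s = 5n at n = 17 and holds at n = 18, from where doubling
    outruns the growth of the cubic. *)
Lemma wt0_small n s : 18 <= n -> s <= 5 * n -> wt0 s <= 604 * 2 ^ (n - 10).
Proof.
move=> n18 /leq_wt0 /leq_trans; apply; rewrite -(leq_pmul2l (_ : 0 < 6)) // wt0_cubic.
rewrite -(subnK n18); elim: (n - 18) => [|k IH]; first by vm_compute.
rewrite addSn; have {n18} : 18 <= k + 18 by apply: leq_addl.
move: (k + 18) IH => {}n IH n18; rewrite subSn; last by lia.
move: IH; rewrite (expnS 2); move: (2 ^ _) => p.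
have h1 : 18 * (n * n) <= n * n * n by rewrite -mulnA leq_mul2r n18 orbT.
have h2 : 18 * n <= n * n by rewrite leq_mul2r n18 orbT.
by rewrite !expnS !expn0 !muln1; lia.
Qed.

(** Level 3 holds at least 105/256 = 420/1024 of the volume, which leaves at most 604/1024 for the
    lower levels. *)
Lemma wt0_large m n : 18 <= n -> 4 * n <= m -> 105 * wt0 (m + n) <= 256 * 'C(m, 3).
Proof.
move=> n18 le_m.
have binE : 6 * 'C(m, 3) + 3 * (m * m) = m * m * m + 2 * m.
  have := wt0_cubic m; have := double_bin2 m.
  by rewrite /wt0 /wt1 /wt2 !expnS expn0 !muln1; lia.
have : 64 * (6 * wt0 (m + n)) <= 125 * (m * m * m) + 400 * m + 384.
  rewrite wt0_cubic.
  have h : 4 * (m + n) <= 5 * m by lia.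
  have : (4 * (m + n)) ^ 3 <= (5 * m) ^ 3 by rewrite leq_exp2r.
  rewrite !expnS !expn0 !muln1; lia.
have h1 : 72 * (m * m) <= m * m * m by rewrite -mulnA leq_mul2r; apply/orP; right; lia.
have h2 : 72 * m <= m * m by rewrite leq_mul2r; apply/orP; right; lia.
lia.
Qed.

Lemma winT_large m n : 18 <= n -> wt0 (m + n) <= 2 ^ n -> winT n 1 m 'C(m, 2) 'C(m, 3).
Proof.
move=> n18 leV; have n10 : 10 <= n by lia.
have lowE := low_binom m n; have powE : 2 ^ n = 1024 * 2 ^ (n - 10).
  by rewrite -{1}(subnKC n10) expnD.
have fill : fillable n 1 m 'C(m, 2); last by apply: fill; lia.
rewrite -(subnKC n10); apply: fillable_low => //; rewrite subnKC //.
apply: (leq_trans _ (leq_addr _ _)); case: (leqP (4 * n) m) => le_m.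
  by have := wt0_large n18 le_m; lia.
have : wt0 (m + n) <= 604 * 2 ^ (n - 10) by apply: wt0_small => //; lia.
by lia.
Qed.

(* The largest m with 2^m * wt0 (m + n) <= 2^(m + n), for 10 <= n < 18. *)
Definition largest_m : seq (nat * nat) :=
  [:: (10, 8); (11, 12); (12, 17); (13, 23); (14, 32); (15, 43); (16, 57); (17, 75)].

Definition start_state (m : nat) : low_state := (1%num, N.of_nat m, N.of_nat 'C(m, 2)).

Lemma largest_m_bound :
  all (fun p => ((wtN (p.2 + p.1)).1.1 <=? powN p.1) &&
                (powN p.1 <? (wtN (p.2 + p.1).+1).1.1))%num largest_m.
Proof. by vm_compute. Qed.

Lemma largest_m_layer : all (fun p => layer p.1 [:: start_state p.2]) largest_m.
Proof. by vm_compute. Qed.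

Lemma layer_winT n m : layer n [:: start_state m] -> wt0 (m + n) <= 2 ^ n ->
  winT n 1 m 'C(m, 2) 'C(m, 3).
Proof.
move=> /layer_sound /(_ _ (mem_head _ _)); rewrite /= !Nat2N.id => fill leV.
by apply: fill; rewrite addnC low_binom.
Qed.

(** By monotonicity only the largest admissible m for each n has to be computed. *)
Lemma winT_middle m n : 10 <= n < 18 -> wt0 (m + n) <= 2 ^ n ->
  winT n 1 m 'C(m, 2) 'C(m, 3).
Proof.
move=> n_mid leV; have : n \in unzip1 largest_m by rewrite (_ : unzip1 _ = iota 10 8) // mem_iota.
case/mapP=> -[n' M] nM /= nE; subst n'.
have /allP/(_ _ nM)/andP[/N.leb_spec0 + /N.ltb_spec0] := largest_m_bound.
rewrite powNE !wtNE /fst /snd => leM ltM.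
have le_m : m <= M.
  rewrite leqNgt; apply/negP => lt_m.
  have : wt0 (M + n).+1 <= wt0 (m + n) by apply: leq_wt0; lia.
  by lia.
have /allP/(_ _ nM) /= /layer_winT win := largest_m_layer.
apply: (winT_mono _ _ _ _ (win _)) => //; try exact: leq_bin2l.
by lia.
Qed.

(** * The minimal number of questions and the conclusion *)

Lemma wt0_sum q : \sum_(i < 4) 'C(q, i) = wt0 q.
Proof. by rewrite !big_ord_recr big_ord0 /= bin0 bin1 /wt0 /wt1 /wt2; lia. Qed.

Lemma berlekampD m n : berlekamp m (m + n) = (wt0 (m + n) <= 2 ^ n).
Proof. by rewrite /berlekamp wt0_sum expnD leq_pmul2l // expn_gt0. Qed.

Lemma Nmin_exists m : exists n, is_Nmin m (m + n).
Proof.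
have ex : exists q, berlekamp m q.
  (* With n = m + 18 one has m + n <= 5n, as [wt0_small] requires. *)
  exists (m + (m + 18)); rewrite berlekampD.
  have n10 : 10 <= m + 18 by lia.
  apply: (leq_trans (@wt0_small (m + 18) _ _ _)); try lia.
  by rewrite -[in leqRHS](subnKC n10) expnD leq_mul2r orbT.
case: (ex_minnP ex) => q bq qmin; exists (q - m); rewrite subnKC; last first.
  (* m <= q, because 2^m <= 2^m * wt0 q <= 2^q. *)
  rewrite -(leq_exp2l _ _ (ltnSn 1)); apply: leq_trans bq.
  by rewrite wt0_sum -{1}[2 ^ m]muln1 leq_mul2l /wt0 /wt1 /wt2 !addnS orbT.
by split=> // q' lt_q'; apply: contraL lt_q' => /qmin; rewrite -leqNgt.
Qed.

Lemma Nmin_by_computation m n :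
  all (fun q => ~~ (2 ^ m * wt0 q <= 2 ^ q)) (iota 0 (m + n)) -> wt0 (m + n) <= 2 ^ n ->
  is_Nmin m (m + n).
Proof.
move=> /allP small leV; split=> [|q' lt_q']; first by rewrite berlekampD.
by have := small q'; rewrite mem_iota /berlekamp wt0_sum; apply.
Qed.

Theorem theorem3 (m : nat) :
  m \notin [:: 2; 3; 5] ->
  exists t : strategy (2 ^ m), perfect t /\ all_questions (@four_interval (2 ^ m)) t.
Proof.
move=> m235; case: (leqP 6 m) => [m6|].
  have [n nmin] := Nmin_exists m; apply: (winT_perfect nmin).
  case: nmin => + _; rewrite berlekampD => leV.
  (* For n < 10 the volume bound already fails at m = 6, hence for every larger m. *)
  have n10 : 10 <= n.
    rewrite leqNgt; apply/negP => n9.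
    have : 2 ^ n < wt0 (6 + n).
      have /allP : all (fun n => 2 ^ n < wt0 (6 + n)) (iota 0 10) by vm_compute.
      by apply; rewrite mem_iota.
    by have : wt0 (6 + n) <= wt0 (m + n) by [apply: leq_wt0; lia]; lia.
  case: (ltnP n 18) => n18; last exact: winT_large.
  by apply: winT_middle => //; rewrite n10.
(* The remaining cases m = 0, 1, 4 need 0, 7 and 13 questions. *)
case: m m235 => [|[|[|[|[|[|m]]]]]] // _ _.
- by apply: (@winT_perfect 0 0) => //; apply: Nmin_by_computation.
- by apply: (@winT_perfect 1 6); [apply: Nmin_by_computation | apply: layer_winT]; vm_compute.
- by apply: (@winT_perfect 4 9); [apply: Nmin_by_computation | apply: layer_winT]; vm_compute.
Qed.
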